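(* For all $0<\alpha,\beta<1$ and all $n,l\in\mathbb{N}$ we have $$\alpha\text{-}AC^{(n)}(\Omega,\mathbb{R}^l)=\beta\text{-}AC^{(n)}(\Omega,\mathbb{R}^l).$$ However, the choice of $\delta>0$ in the implication $$\sum_{i=1}^k\mathcal{L}^n([\mathbf{a}_i,\mathbf{b}_i])<\delta\ \Rightarrow\ \sum_{i=1}^k|f(\mathbf{a}_i)-f(\mathbf{b}_i)|^n<\varepsilon$$ that defines $\alpha$-absolute continuity cannot be made uniformly for all $\alpha\in(0,1)$.
   Context: $\Omega\subset\mathbb{R}^n$ is open, $\mathcal{L}^n$ denotes Lebesgue measure on $\mathbb{R}^n$ and $|\cdot|$ the Euclidean norm. An interval in $\mathbb{R}^n$ is a set $[\mathbf{a},\mathbf{b}]=\{\mathbf{x}=(x_\nu)_{\nu=1}^n\in\mathbb{R}^n: a_\nu\le x_\nu\le b_\nu,\ \nu=1,\dots,n\}$. For $0<\alpha<1$, the interval $[\mathbf{a},\mathbf{b}]$ is called $\alpha$-regular if $$\frac{\mathcal{L}^n([\mathbf{a},\mathbf{b}])}{(\max_\nu|a_\nu-b_\nu|)^n}\ge\alpha.$$ For $0<\alpha<1$, a function $f:\Omega\to\mathbb{R}^l$ is said to be $\alpha$-absolutely continuous (in the sense of Bongiorno), and the class of such functions is denoted $\alpha\text{-}AC^{(n)}(\Omega,\mathbb{R}^l)$, if for all $\varepsilon>0$ there exists $\delta>0$ such that for any finite collection of disjoint $\alpha$-regular intervals $\{[\mathbf{a}_i,\mathbf{b}_i]\subset\Omega\}_{i=1}^k$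 we have $$\sum_{i=1}^k\mathcal{L}^n([\mathbf{a}_i,\mathbf{b}_i])<\delta\ \Rightarrow\ \sum_{i=1}^k|f(\mathbf{a}_i)-f(\mathbf{b}_i)|^n<\varepsilon.$$
   Formalization: The non-uniformity of δ is stated for n ≥ 2 and nonempty Ω, as existence of one f lying in every class: for n = 1 every nondegenerate interval is α-regular for all α, so δ is uniform, and for empty Ω there are no intervals. *)

(* Defs.v *)
From HB Require Import structures.
From mathcomp Require Import all_boot all_order all_algebra.
From mathcomp Require Import all_classical all_reals all_analysis.

Set Implicit Arguments.
Unset Strict Implicit.
Unset Printing Implicit Defensive.

Import Order.TTheory GRing.Theory Num.Theory.
Import numFieldNormedType.Exports.

Local Open Scope classical_set_scope.
Local Open Scope ring_scope.

Definition box (R : realType) (n : nat) (a b : 'rV[R]_n) : set 'rV[R]_n :=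
  [set x | forall j : 'I_n, a ord0 j <= x ord0 j <= b ord0 j].

(* Lebesgue (outer) measure on R^n: the infimum of the total volume of the
   countable covers by boxes.  MathComp-Analysis only provides it for n = 1. *)
Definition lebesgue_rV (R : realType) (n : nat) (A : set 'rV[R]_n) : \bar R :=
  ereal_inf [set v : \bar R | exists a b : nat -> 'rV[R]_n,
    [/\ forall k j, a k ord0 j <= b k ord0 j,
        A `<=` \bigcup_k box (a k) (b k) &
        v = (\sum_(0 <= k <oo)
               (\prod_(j < n) (b k ord0 j - a k ord0 j))%:E)%E]].

(* The norm that MathComp-Analysis puts on 'rV[R]_l is the maximum norm, hence
   this explicit Euclidean norm. *)
Definition enorm (R : realType) (l : nat) (v : 'rV[R]_l) : R :=
  Num.sqrt (\sum_(j < l) v ord0 j ^+ 2).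

(* No ordering of [a] and [b] is required: [box a b] is empty or degenerate,
   and the quotient is 0, unless [a] is below [b] in every coordinate (this
   covers [a = b], as 0 / 0 = 0 here); so a regular box is nondegenerate. *)
Definition alpha_regular (R : realType) (n : nat) (alpha : R)
    (a b : 'rV[R]_n) : Prop :=
  alpha <= fine (lebesgue_rV (box a b)) /
           (\big[Num.max/0]_(j < n) `|a ord0 j - b ord0 j|) ^+ n.

Definition AC_implication (R : realType) (n l : nat) (Omega : set 'rV[R]_n)
    (f : 'rV[R]_n -> 'rV[R]_l) (alpha eps delta : R) : Prop :=
  forall (k : nat) (a b : 'I_k -> 'rV[R]_n),
    (forall i, alpha_regular alpha (a i) (b i)) ->
    (forall i, box (a i) (b i) `<=` Omega) ->
    trivIset setT (fun i => box (a i) (b i)) ->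
    (\sum_(i < k) lebesgue_rV (box (a i) (b i)) < delta%:E)%E ->
    \sum_(i < k) enorm (f (a i) - f (b i)) ^+ n < eps.

(* A function Omega -> R^l is represented by a total function; only its values
   on Omega matter, since the corners of a nonempty box lie in the box. *)
Definition alphaAC (R : realType) (n l : nat) (alpha : R)
    (Omega : set 'rV[R]_n) : set ('rV[R]_n -> 'rV[R]_l) :=
  [set f | forall eps : R, 0 < eps ->
     exists2 delta : R, 0 < delta & AC_implication Omega f alpha eps delta].

(* Main.v *)
(* If [a, b] is alpha-regular, then [f a - f b] is a sum of a number N of
   increments of f along beta-regular intervals contained in [a, b], where N
   depends only on n, alpha and beta. The intervals with a given index, one in
   each member of a disjoint family, are again disjoint and have no larger
   total measure, so beta-absolute continuity applies N times.

   The first coordinate is Lipschitz, hence alpha-absolutely continuous for every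
   alpha, but [x, x + (r, s, ..., s)] has small measure for small s while the
   increment over it is r: no delta serves all alpha. *)
Require Import Defs.
From HB Require Import structures.
From mathcomp Require Import all_boot all_order all_algebra.
From mathcomp Require Import all_classical all_reals all_analysis.
From mathcomp Require Import measurable_realfun.
From mathcomp Require Import ring lra.
Import Order.TTheory GRing.Theory Num.Theory.
Import numFieldNormedType.Exports.
Local Open Scope classical_set_scope.
Local Open Scope ring_scope.

(** * Lebesgue measure of boxes *)

(* Slice the cover at [x n = t], apply the induction hypothesis to the boxes
   that meet the slice, and integrate over [t]. *)
Lemma volume_le_cover (R : realType) (n : nat) (a b : nat -> R)
    (A B : nat -> nat -> R) (D : pred nat) :
  (forall i, (i < n)%N -> a i <= b i) ->
  (forall k i, (i < n)%N -> A k i <= B k i) ->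
  (forall x : nat -> R, (forall i, (i < n)%N -> a i <= x i <= b i) ->
     exists2 k, D k & forall i, (i < n)%N -> A k i <= x i <= B k i) ->
  ((\prod_(i < n) (b i - a i))%:E <=
     \sum_(0 <= k <oo) ((D k)%:R * \prod_(i < n) (B k i - A k i))%:E)%E.
Proof.
elim: n D => [|n IHn] D ab AB cover.
  (* In dimension 0 the cover must contain some box [k] in [D], and its empty product already
     contributes 1. *)
  have [//|k Dk _] := cover a.
  rewrite big_ord0 (@nneseriesD1 _ _ k) //=; last first.
    by move=> j _; rewrite lee_fin big_ord0 mulr1 ler0n.
  rewrite Dk big_ord0 mulr1 leeDl//.
  apply: nneseries_ge0 => j _ _; by rewrite lee_fin big_ord0 mulr1 ler0n.
pose W k := \prod_(i < n) (B k i - A k i).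
have W0 k : 0 <= W k.
  by apply: prodr_ge0 => i _; rewrite subr_ge0 AB// ltnS ltnW.
(* For [k] in [D], this is the [n]-volume of the slice of box [k] at height [t]; integrated over all
   [t] it gives the full volume of the box. *)
pose g (k : nat) : R -> \bar R := fun t =>
  ((D k)%:R * W k * \1_[set` `[A k n, B k n]] t)%:E.
have g0 k t : (0 <= g k t)%E by rewrite lee_fin !mulr_ge0.
have mg k : measurable_fun (setT : set R) (g k).
  apply/measurable_EFinP; apply: measurable_funM => //.
have slice t : t \in `[a n, b n] ->
    ((\prod_(i < n) (b i - a i))%:E <= \sum_(0 <= k <oo) g k t)%E.
  rewrite in_itv/= => tab.
  (* Here lies the purpose of the predicate [D]: the boxes that miss the slice are dropped without
     reindexing the family. *)
  pose D' k := D k && (A k n <= t <= B k n).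
  apply: (@le_trans _ _ (\sum_(0 <= k <oo) ((D' k)%:R * W k)%:E)%E).
    apply: IHn.
    - by move=> i ltin; apply: ab; rewrite ltnS ltnW.
    - by move=> k i ltin; apply: AB; rewrite ltnS ltnW.
    - move=> x xab.
      have [|k Dk xk] := cover (fun i => if i == n then t else x i).
        move=> i; rewrite ltnS leq_eqVlt => /predU1P[->|ltin].
          by rewrite eqxx.
        by rewrite (ltn_eqF ltin) xab.
      exists k; first by have := xk n (ltnSn n); rewrite /D' eqxx Dk.
      by move=> i ltin; have := xk i (ltnW ltin); rewrite (ltn_eqF ltin).
  apply: lee_nneseries => k _; first by rewrite lee_fin mulr_ge0.
  by rewrite lee_fin indicE mem_setE in_itv /= /D' mulrAC -natrM mulnb.
rewrite big_ord_recr /=.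
have ltn := ab n (ltnSn n).
have lenE (c d : R) : c <= d -> lebesgue_measure [set` `[c, d]] = (d - c)%:E.
  rewrite lebesgue_measure_itv /= lte_fin le_eqVlt => /predU1P[->|->] //.
  by rewrite ltxx subrr.
have -> : ((\prod_(i < n) (b i - a i) * (b n - a n))%:E =
    \int[lebesgue_measure]_(t in [set` `[a n, b n]])
       cst (\prod_(i < n) (b i - a i))%:E t)%E.
  by rewrite integral_cst // [X in (_ * X)%E](lenE _ _ ltn).
apply: (@le_trans _ _ (\int[lebesgue_measure]_(t in [set` `[a n, b n]])
    \sum_(0 <= k <oo) g k t)%E).
  apply: ge0_le_integral => //.
  - move=> t _ /=; rewrite lee_fin; apply: prodr_ge0 => i _.
    by rewrite subr_ge0 ab// ltnS ltnW.
  - apply: (@ge0_emeasurable_sum _ _ _ _ (fun k t => g k t) predT) => //.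
    by move=> k _; apply: measurable_funTS.
rewrite integral_nneseries //; last by move=> k; apply: measurable_funS (mg k).
apply: lee_nneseries => k _; first by move=> _; apply: integral_ge0.
rewrite /g big_ord_recr /= -/(W k).
under eq_integral do rewrite EFinM.
rewrite ge0_integralZl_EFin //; last 2 first.
- by apply/measurable_EFinP; apply: measurable_funTS.
- by rewrite mulr_ge0.
rewrite integral_indic // mulrA [in leRHS]EFinM.
rewrite lee_wpmul2l ?lee_fin ?mulr_ge0 //.
rewrite -[leRHS]lenE ?AB //.
by apply: le_measure; rewrite ?inE//; apply: measurableI.
Qed.

Lemma lebesgue_rV_ge0 (R : realType) (n : nat) (A : set 'rV[R]_n) :
  (0 <= lebesgue_rV A)%E.
Proof.
apply: le_ereal_inf_tmp => _ [a [b [ab _ ->]]].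
apply: nneseries_ge0 => k _ _; rewrite lee_fin.
by apply: prodr_ge0 => j _; rewrite subr_ge0.
Qed.

Lemma le_lebesgue_rV (R : realType) (n : nat) (A B : set 'rV[R]_n) :
  A `<=` B -> (lebesgue_rV A <= lebesgue_rV B)%E.
Proof.
move=> AB; apply: le_ereal_inf => v [a [b [ab Bab ->]]].
by exists a, b; split=> //; apply: subset_trans Bab.
Qed.

(** The cover is [box a b] followed by copies of the degenerate box at 0. These have volume 0
    because the dimension is positive; an empty product would be 1. *)
Lemma lebesgue_rV_le_box (R : realType) (n : nat) (A : set 'rV[R]_n.+1)
    (a b : 'rV[R]_n.+1) :
  (forall j, a ord0 j <= b ord0 j) -> A `<=` box a b ->
  (lebesgue_rV A <= (\prod_(j < n.+1) (b ord0 j - a ord0 j))%:E)%E.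
Proof.
move=> ab Aab; apply: ereal_inf_lbound.
exists (fun k => if k == 0%N then a else 0), (fun k => if k == 0%N then b else 0).
split=> [[|k] j //|x /Aab abx|]; first by exists 0%N.
rewrite (@nneseriesD1 _ _ 0%N) //=.
  rewrite eseries0 ?adde0 // => -[|k] _ //= _.
  by rewrite big_ord_recl !mxE subrr mul0r.
by move=> [|k] _; rewrite lee_fin; apply: prodr_ge0 => j _; rewrite subr_ge0.
Qed.

Lemma lebesgue_rV_box (R : realType) (n : nat) (a b : 'rV[R]_n.+1) :
  (forall j, a ord0 j <= b ord0 j) ->
  lebesgue_rV (box a b) = (\prod_(j < n.+1) (b ord0 j - a ord0 j))%:E.
Proof.
move=> ab; apply/eqP; rewrite eq_le lebesgue_rV_le_box //=.
apply: le_ereal_inf_tmp => _ [A [B [AB cover ->]]].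
(* Rows are turned into sequences by [inord]; only the indices below [n.+1] matter. *)
have:= @volume_le_cover R n.+1 (fun i => a ord0 (inord i))
  (fun i => b ord0 (inord i)) (fun k i => A k ord0 (inord i))
  (fun k i => B k ord0 (inord i)) predT.
have inordE (c d : 'rV[R]_n.+1) :
    \prod_(i < n.+1) (c ord0 (inord i) - d ord0 (inord i)) =
    \prod_(i < n.+1) (c ord0 i - d ord0 i).
  by apply: eq_bigr => i _; rewrite inord_val.
rewrite inordE; under eq_eseriesr do rewrite inordE mul1r.
apply=> // x xab.
have [|k _ xk] := cover (\row_j x j).
  by move=> j; rewrite mxE; have := xab j (ltn_ord j); rewrite inord_val.
exists k => // i ltin; have := xk (inord i).
by rewrite mxE inordK.
Qed.

(** * Side lengths of regular intervals *)

(** [M] is the longest side. Bounding all sides but one by [M] in the volume and cancelling [M ^+ n]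
    shows that the remaining side is at least [alpha * M]. *)
Lemma regular_sides (R : realType) (n : nat) (alpha : R) (a b : 'rV[R]_n.+1) :
  0 < alpha -> alpha_regular alpha a b ->
  exists M : R, [/\ 0 < M, forall j, alpha * M <= b ord0 j - a ord0 j <= M &
    alpha * M ^+ n.+1 <= \prod_(j < n.+1) (b ord0 j - a ord0 j)].
Proof.
move=> alpha0; rewrite /alpha_regular.
set M := \big[Num.max/0]_j _ => reg.
have ab : forall j, a ord0 j <= b ord0 j.
  apply: contrapT => /existsNP [j nab]; move: reg; rewrite leNgt => /negP; apply.
  have -> : lebesgue_rV (box a b) = 0%E.
    apply/eqP; rewrite eq_le lebesgue_rV_ge0 andbT.
    apply: (le_trans (@lebesgue_rV_le_box _ _ _ 0 0 _ _)) => //.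
      by move=> x /(_ j) /andP[/le_trans/[apply] /nab].
    by rewrite big_ord_recl subrr mul0r.
  by rewrite /= mul0r.
have M0 : 0 < M.
  rewrite lt_neqAle bigmax_ge_id andbT; apply: contraTneq reg => <-.
  by rewrite expr0n /= invr0 mulr0 -ltNge.
have sM j : b ord0 j - a ord0 j <= M.
  rewrite (le_trans (ler_norm _)) // distrC.
  by rewrite (le_bigmax _ (fun j => `|a ord0 j - b ord0 j|)).
move: reg; rewrite lebesgue_rV_box //= ler_pdivlMr ?exprn_gt0 // => reg.
exists M; split=> // j; rewrite sM andbT -(ler_pM2r (exprn_gt0 n M0)) -mulrA -exprS.
apply: (le_trans reg); rewrite (bigD1 j) //= ler_wpM2l ?subr_ge0 //.
have -> : M ^+ n = \prod_(i in predC1 j) M.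
  by rewrite prodr_const cardC1 card_ord.
by apply: ler_prod => i _; rewrite subr_ge0 ab sM.
Qed.

(** The volume is at least [t ^+ n.+1], while the longest side is at most [u]. *)
Lemma near_cube_regular (R : realType) (n : nat) (beta t u : R)
    (a b : 'rV[R]_n.+1) :
  0 < t -> beta * u ^+ n.+1 <= t ^+ n.+1 ->
  (forall j, t <= b ord0 j - a ord0 j <= u) -> alpha_regular beta a b.
Proof.
move=> t0 tu s; rewrite /alpha_regular.
have ab j : a ord0 j <= b ord0 j.
  by rewrite -subr_ge0; have /andP[/(le_trans (ltW t0))] := s j.
set M := \big[Num.max/0]_j _.
have Mu : M <= u.
  apply: bigmax_le => [|j _].
    by have /andP[] := s ord0; move=> /(lt_le_trans t0)/lt_le_trans/[apply]/ltW.
  by rewrite distrC ger0_norm ?subr_ge0 //; have /andP[] := s j.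
have M0 : 0 < M.
  apply: (lt_le_trans t0); apply: le_trans (le_bigmax _ _ ord0).
  by rewrite distrC (le_trans _ (ler_norm _)) //; have /andP[] := s ord0.
rewrite lebesgue_rV_box //= ler_pdivlMr ?exprn_gt0 //.
have [beta0|/ltW beta0] := leP 0 beta; last first.
  apply: (@le_trans _ _ 0); first by rewrite mulr_le0_ge0 // exprn_ge0 // ltW.
  by apply: prodr_ge0 => j _; rewrite subr_ge0.
apply: (@le_trans _ _ (t ^+ n.+1)).
  apply: le_trans tu; rewrite ler_wpM2l //.
  by rewrite lerXn2r ?nnegrE ?(le_trans (ltW M0)) // ltW.
rewrite -[in leLHS](card_ord n.+1) -prodr_const; apply: ler_prod => j _.
by rewrite (ltW t0); have /andP[] := s j.
Qed.

(** * Chains of nearly cubic intervals *)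

(** Bernoulli's inequality on [0, 1], where the induction may multiply by [1 - x]. *)
Lemma ler_expr1B (R : realDomainType) (x : R) (n : nat) :
  0 <= x <= 1 -> 1 - n%:R * x <= (1 - x) ^+ n.
Proof.
move=> /andP[x0 x1]; elim: n => [|n IHn]; first by rewrite mul0r subr0 expr0.
have n0 : 0 <= n%:R :> R by exact: ler0n.
rewrite exprSr -natr1; apply: (@le_trans _ _ ((1 - n%:R * x) * (1 - x))).
  by nra.
by rewrite ler_wpM2r // subr_ge0.
Qed.

(* The segment from [a] to [b] is cut into [2m] pieces. With [h] the
   diagonal of a piece and [T] half of the least possible side of [box a b],
   each step [u, u + h] is replaced by [u, u + h + T(1,...,1)], run forward, and
   [u + h, u + h + T(1,...,1)], run backward; in the second half of the segment
   the detour goes through [u - T(1,...,1)] so as to remain inside [box a b].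
   As [h] is small compared with [T], these boxes are almost cubes. *)
Lemma regular_chain (R : realType) (n : nat) (alpha beta : R) :
  0 < alpha -> 0 < beta < 1 ->
  exists N : nat, forall a b : 'rV[R]_n.+1, alpha_regular alpha a b ->
    exists pq : 'I_N * bool -> 'rV[R]_n.+1 * 'rV[R]_n.+1,
    [/\ forall t, alpha_regular beta (pq t).1 (pq t).2,
        forall t, box (pq t).1 (pq t).2 `<=` box a b &
        forall g : 'rV[R]_n.+1 -> R,
          `|g a - g b| <= \sum_t `|g (pq t).1 - g (pq t).2| ].
Proof.
move=> alpha0 /andP[beta0 beta1].
have ab0 : 0 < alpha * (1 - beta) by rewrite mulr_gt0 // subr_gt0.
(* With [x = 1 / (alpha * m)], which will bound the ratio [h i / T], this choice gives
   [n.+1 * x <= 1 - beta]. *)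
have [m mlt] : exists m : nat, n.+1%:R / (alpha * (1 - beta)) < m%:R.
  exists (Num.bound (n.+1%:R / (alpha * (1 - beta)))).
  by apply: archi_boundP; rewrite divr_ge0 ?ler0n // ltW.
have m0 : 0 < m%:R :> R.
  by apply: le_lt_trans mlt; rewrite divr_ge0 ?ler0n // ltW.
have am0 : 0 < alpha * m%:R by rewrite mulr_gt0.
exists (m + m)%N => a b /(regular_sides _ _ _ _ _ alpha0)[M [M0 sides _]].
pose h i := (b ord0 i - a ord0 i) / (m + m)%:R.
have hE i : b ord0 i - a ord0 i = m%:R * h i + m%:R * h i.
  by rewrite /h natrD; field; lra.
have aM0 : 0 < alpha * M by rewrite mulr_gt0.
have h0 i : 0 <= h i.
  have /andP[s1 _] := sides i.
  by rewrite /h divr_ge0 ?ler0n // (le_trans _ s1) // ltW.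
pose T := alpha * M / 2.
have T0 : 0 < T by rewrite divr_gt0.
(* Half of each side is at least [T], so [u k + T] for [k <= m] and [u k - T] for [k >= m] stay
   between [a] and [b]. *)
have Th i : T <= m%:R * h i by have := sides i; rewrite hE /T; lra.
have hM i : h i <= M / (m + m)%:R.
  by rewrite ler_wpM2r ?invr_ge0 ?ler0n //; have /andP[] := sides i.
pose u (k : nat) : 'rV[R]_n.+1 := \row_i (a ord0 i + k%:R * h i).
pose c (j : nat) : 'rV[R]_n.+1 :=
  \row_i (if (j < m)%N then u j.+1 ord0 i + T else u j ord0 i - T).
(* The boolean selects the end or the start of the step as the corner opposite to [c]; [pq] puts the
   lower corner first. *)
pose v (t : 'I_(m + m) * bool) := if t.2 then u t.1.+1 else u t.1.
pose pq (t : 'I_(m + m) * bool) :=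
  if (t.1 < m)%N then (v t, c t.1) else (c t.1, v t).
have kh (k l : nat) i : (k <= l)%N -> k%:R * h i <= l%:R * h i.
  by move=> kl; rewrite ler_wpM2r // ler_nat.
have u_in k i : (k <= m + m)%N -> a ord0 i <= u k ord0 i <= b ord0 i.
  move=> kmm; have := kh _ _ i kmm; have := kh _ _ i (leq0n k).
  by rewrite mxE natrD; have := hE i; lra.
have v_in t i : a ord0 i <= v t ord0 i <= b ord0 i.
  by case: t => j [] /=; apply: u_in; rewrite /= ?ltn_ord // ltnW.
have vc (t : 'I_(m + m) * bool) i : if (t.1 < m)%N then
    (T <= c t.1 ord0 i - v t ord0 i <= T + h i) /\ c t.1 ord0 i <= b ord0 i
  else (T <= v t ord0 i - c t.1 ord0 i <= T + h i) /\ a ord0 i <= c t.1 ord0 i.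
  case: t => j e /=; have := h0 i; have := Th i; have := hE i.
  case: ltnP => jm; rewrite /c /v ?jm ?(ltnNge j m) ?jm /= => ? ? ?.
    have := kh _ _ i jm.
    by case: e; rewrite !mxE -?natr1; lra.
  have := kh _ _ i jm.
  by case: e; rewrite !mxE -?natr1; lra.
exists pq; split.
- move=> t; apply: (@near_cube_regular _ _ _ T (T + M / (m + m)%:R)) => //.
    pose x := (alpha * m%:R)^-1.
    have xE : x * (alpha * m%:R) = 1 by rewrite mulVf // gt_eqF.
    have x0 : 0 < x by rewrite invr_gt0.
    have xn : n.+1%:R * x <= 1 - beta.
      rewrite ler_pdivrMr // mulrCA mulrA.
      by move: mlt; rewrite ltr_pdivrMr // => /ltW; lra.
    have x1 : 0 <= x <= 1.
      have : 0 <= n%:R * x by rewrite mulr_ge0 ?ler0n // ltW.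
      by move: xn; rewrite -natr1; lra.
    (* All sides lie between [T] and [(1 + x) * T], so it suffices that [beta <= (1 - x) ^+ n.+1]
       and [(1 - x) * (1 + x) <= 1]. *)
    apply: (@le_trans _ _ ((1 - x) ^+ n.+1 * (T + M / (m + m)%:R) ^+ n.+1)).
      have U0 : 0 <= T + M / (m + m)%:R.
        by rewrite addr_ge0 ?divr_ge0 ?ler0n // ltW.
      rewrite ler_wpM2r ?exprn_ge0 //.
      by apply: le_trans (ler_expr1B _ _ n.+1 x1); lra.
    have Mx : M / (m + m)%:R = x * T.
      rewrite natrD /x /T; field; lra.
    have xT : 0 <= x * T by rewrite mulr_ge0 // ltW.
    rewrite -exprMn Mx lerXn2r ?nnegrE; [|nra|exact: ltW|nra].
    by nra.
  by move=> i; have := vc t i; have := hM i; rewrite /pq; case: ifP => _ /=; lra.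
- move=> t x xpq i; have := xpq i; have := vc t i; have := v_in t i.
  by rewrite /pq; case: ifP => _ /=; lra.
- move=> g.
  have u0 : u 0%N = a by apply/rowP => i; rewrite mxE mul0r addr0.
  have uN : u (m + m)%N = b.
    by apply/rowP => i; rewrite mxE natrD mulrDl -hE addrC subrK.
  (* The increment telescopes along the points [u k]; each step then passes through [c j] by the
     triangle inequality. *)
  rewrite -{1}u0 -uN distrC -(telescope_sumr (fun k => g (u k))) // big_mkord.
  apply: (le_trans (ler_norm_sum _ _ _)).
  rewrite -(pair_bigA _ (fun j e => `|g (pq (j, e)).1 - g (pq (j, e)).2|)) /=.
  apply: ler_sum => j _; rewrite big_bool /pq /v /=.
  case: ifP => _ /=.
    by rewrite [X in _ <= _ + X]distrC ler_distD.
  by rewrite [X in _ <= X + _]distrC ler_distD.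
Qed.

(** * Independence of the class from alpha *)

Lemma normr_le_enorm (R : realType) (l : nat) (v : 'rV[R]_l) (j : 'I_l) :
  `|v ord0 j| <= enorm v.
Proof.
rewrite -sqrtr_sqr ler_wsqrtr // (bigD1 j) //= lerDl.
by apply: sumr_ge0 => i _; rewrite sqr_ge0.
Qed.

Lemma enorm_ge0 (R : realType) (l : nat) (v : 'rV[R]_l) : 0 <= enorm v.
Proof. exact: sqrtr_ge0. Qed.

Lemma enorm_le_sum (R : realType) (l : nat) (v : 'rV[R]_l) :
  enorm v <= \sum_j `|v ord0 j|.
Proof.
have S0 : 0 <= \sum_j `|v ord0 j| by exact: sumr_ge0.
rewrite -[leRHS]ger0_norm // -sqrtr_sqr ler_wsqrtr // [leRHS]expr2 mulr_suml.
apply: ler_sum => j _; rewrite -real_normK ?num_real // expr2.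
rewrite ler_wpM2l // (bigD1 j) //= lerDl; exact: sumr_ge0.
Qed.

(** Both sides are compared with the maximum [m]: the sum is at most [#|I| * m], and [m ^+ n.+1] is
    at most the sum of the powers. *)
Lemma exprS_sum_le (R : realDomainType) (I : finType) (n : nat) (e : I -> R) :
  (forall t, 0 <= e t) ->
  (\sum_t e t) ^+ n.+1 <= #|I|%:R ^+ n.+1 * \sum_t e t ^+ n.+1.
Proof.
move=> e0; pose m := \big[Num.max/0]_t e t.
have S0 : 0 <= \sum_t e t ^+ n.+1 by apply: sumr_ge0 => t _; rewrite exprn_ge0.
have mS : m ^+ n.+1 <= \sum_t e t ^+ n.+1.
  rewrite /m; elim/big_ind: _ => [|x y xS yS|t _].
  - by rewrite expr0n.
  - by case: (leP x y).
  - rewrite (bigD1 t) //= lerDl; apply: sumr_ge0 => s _; exact: exprn_ge0.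
apply: (@le_trans _ _ ((#|I|%:R * m) ^+ n.+1)); last first.
  by rewrite exprMn ler_wpM2l // exprn_ge0.
rewrite lerXn2r ?nnegrE ?sumr_ge0 ?mulr_ge0 ?bigmax_ge_id //.
rewrite mulr_natl -sumr_const; apply: ler_sum => t _; exact: le_bigmax.
Qed.

Lemma alphaAC_subset (R : realType) (n l : nat) (alpha beta : R)
    (Omega : set 'rV[R]_n.+1) :
  0 < alpha -> 0 < beta < 1 ->
  alphaAC (l := l) beta Omega `<=` alphaAC alpha Omega.
Proof.
move=> alpha0 beta01 f fAC eps eps0.
have [N chain] := regular_chain R n alpha beta alpha0 beta01.
pose I : finType := ('I_N * bool)%type.
(* The first factor comes from the coordinates of [f], the second from [exprS_sum_le], the third
   from adding the bounds over all [t] in [I]. Dividing by [C + 1] below avoids a zero divisor and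
   keeps the final inequality strict. *)
pose C : R := l%:R ^+ n.+1 * #|I|%:R ^+ n.+1 * #|I|%:R.
have C0 : 0 <= C by rewrite !mulr_ge0 ?exprn_ge0.
have [|delta delta0 fdelta] := fAC (eps / (C + 1)).
  by rewrite divr_gt0 // ltr_wpDl.
exists delta => // k a b reg sub triv small.
have /choice[pq pqP] := fun i => chain (a i) (b i) (reg i).
pose e i t := enorm (f (pq i t).1 - f (pq i t).2).
(* The chain controls scalar functions, so it is applied to each of the [l] coordinates of [f]. *)
have fe i : enorm (f (a i) - f (b i)) <= l%:R * \sum_t e i t.
  apply: (le_trans (enorm_le_sum _ _ _)).
  rewrite mulr_natl -[l in leRHS]card_ord -sumr_const; apply: ler_sum => j _.
  have [_ _ gP] := pqP i; have := gP (fun x => f x ord0 j).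
  rewrite !mxE => /le_trans; apply; apply: ler_sum => t _.
  by have := normr_le_enorm _ _ (f (pq i t).1 - f (pq i t).2) j; rewrite !mxE.
have et t : \sum_(i < k) e i t ^+ n.+1 < eps / (C + 1).
  apply: fdelta.
  - by move=> i; have [+ _ _] := pqP i; apply.
  - by move=> i; have [_ + _] := pqP i => /(_ t)/subset_trans; apply.
  - move=> i j _ _ [x [xi xj]]; apply: triv => //; exists x.
    by have [_ pi _] := pqP i; have [_ pj _] := pqP j;
      split; [exact: pi xi|exact: pj xj].
  - apply: le_lt_trans small; apply: lee_sum => i _; apply: le_lebesgue_rV.
    by have [_ + _] := pqP i; apply.
apply: (@le_lt_trans _ _ (C * (eps / (C + 1)))); last first.
  by rewrite mulrA ltr_pdivrMr ?ltr_wpDl //; nra.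
apply: (@le_trans _ _ (\sum_(i < k)
    l%:R ^+ n.+1 * #|I|%:R ^+ n.+1 * \sum_t e i t ^+ n.+1)).
  apply: ler_sum => i _.
  have S0 : 0 <= \sum_t e i t by apply: sumr_ge0 => t _; exact: enorm_ge0.
  apply: (@le_trans _ _ ((l%:R * \sum_t e i t) ^+ n.+1)).
    by rewrite lerXn2r ?nnegrE ?enorm_ge0 // mulr_ge0.
  rewrite exprMn -mulrA ler_wpM2l ?exprn_ge0 //.
  by apply: exprS_sum_le => t; exact: enorm_ge0.
rewrite -mulr_sumr exchange_big /= /C -[leRHS]mulrA ler_wpM2l //.
rewrite mulr_natl -sumr_const; apply: ler_sum => t _; exact: ltW.
Qed.

(** * Failure of uniformity in alpha *)

(** The increment is at most the longest side, whose power [n.+1] is at most the volume divided by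
    [alpha]. Hence [delta = eps * alpha], which tends to 0 with [alpha]. *)
Lemma lipschitz_alphaAC (R : realType) (n l : nat) (alpha : R)
    (Omega : set 'rV[R]_n.+1) (f : 'rV[R]_n.+1 -> 'rV[R]_l) :
  0 < alpha ->
  (forall x y, enorm (f x - f y) <= \big[Num.max/0]_j `|x ord0 j - y ord0 j|) ->
  alphaAC alpha Omega f.
Proof.
move=> alpha0 lip eps eps0; exists (eps * alpha); first exact: mulr_gt0.
move=> k a b reg _ _.
have bound i : exists V : R, lebesgue_rV (box (a i) (b i)) = V%:E /\
    alpha * enorm (f (a i) - f (b i)) ^+ n.+1 <= V.
  have [M [M0 sides MV]] := regular_sides _ _ _ _ _ alpha0 (reg i).
  have s0 j : 0 <= b i ord0 j - a i ord0 j.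
    by have /andP[+ _] := sides j; apply: le_trans; rewrite mulr_ge0 ?ltW.
  exists (\prod_(j < n.+1) (b i ord0 j - a i ord0 j)); split.
    by apply: lebesgue_rV_box => j; rewrite -subr_ge0.
  apply: le_trans MV; rewrite ler_wpM2l ?(ltW alpha0) //.
  rewrite lerXn2r ?nnegrE ?enorm_ge0 ?(ltW M0) //.
  apply: (le_trans (lip _ _)); apply: bigmax_le => [|j _]; first exact: ltW.
  by rewrite distrC ger0_norm //; have /andP[] := sides j.
have /choice[V VP] := bound.
have -> : (\sum_(i < k) lebesgue_rV (box (a i) (b i)) = (\sum_(i < k) V i)%:E)%E.
  by rewrite -sumEFin; apply: eq_bigr => i _; have [] := VP i.
rewrite lte_fin -ltr_pdivrMr // mulrC => /(le_lt_trans _); apply.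
rewrite mulr_sumr; apply: ler_sum => i _.
by rewrite mulrC ler_pdivlMr // mulrC; have [] := VP i.
Qed.

Lemma first_coordinate_not_uniformly_AC (R : realType) (n l : nat)
    (Omega : set 'rV[R]_n.+2) (f : 'rV[R]_n.+2 -> 'rV[R]_l) :
  open Omega -> Omega !=set0 ->
  (forall x y, enorm (f x - f y) = `|x ord0 ord0 - y ord0 ord0|) ->
  ~ (forall eps : R, 0 < eps -> exists2 delta : R, 0 < delta &
       forall alpha : R, 0 < alpha < 1 -> AC_implication Omega f alpha eps delta).
Proof.
move=> oO [x Ox] fE unif.
have [r r0 xr] : exists2 r : R, 0 < r & forall y : 'rV[R]_n.+2,
    (forall j, x ord0 j <= y ord0 j <= x ord0 j + r) -> Omega y.
  have /nbhs_ballP[r /= r0 rO] : nbhs x Omega by exact: open_nbhs_nbhs.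
  exists (r / 2) => [|y xy]; first exact: divr_gt0.
  apply: rO; split=> // i j; rewrite (ord1 i) /ball /=.
  by have := xy j; rewrite ltr_norml; lra.
(* This [eps] is exactly the power of an increment [r], so the strict inequality must fail. *)
have [delta delta0 /= AC] := unif (r ^+ n.+2) (exprn_gt0 _ r0).
(* One short side [s] and the bound [r] for all the others give a volume of at most
   [s * r ^+ n.+1 <= delta / 2]. *)
pose s := Num.min r (delta / (2 * r ^+ n.+1)).
have s0 : 0 < s by rewrite lt_min r0 divr_gt0 // mulr_gt0 // exprn_gt0.
have sr : s <= r by rewrite ge_min lexx.
pose side (j : 'I_n.+2) := if j == ord0 then r else s.
have side_gt0 j : 0 < side j by rewrite /side; case: eqP.
have side_le j : side j <= r by rewrite /side; case: eqP.
pose y : 'rV[R]_n.+2 := \row_j (x ord0 j + side j).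
have xyE j : y ord0 j - x ord0 j = side j by rewrite mxE addrC addKr.
have xy j : x ord0 j <= y ord0 j by rewrite -subr_ge0 xyE ltW.
have volE : lebesgue_rV (box x y) = (\prod_j side j)%:E.
  by rewrite lebesgue_rV_box //; congr EFin; apply: eq_bigr => j _.
have vol_gt0 : 0 < \prod_j side j by apply: prodr_gt0.
have vol_lt : \prod_j side j < delta.
  rewrite big_ord_recl /= big_ord_recl /= {1 2}/side /=.
  apply: (@le_lt_trans _ _ (r * (s * r ^+ n))).
    rewrite ler_wpM2l ?(ltW r0) // ler_wpM2l ?(ltW s0) //.
    rewrite -[n in leRHS](card_ord n) -prodr_const; apply: ler_prod => j _.
    by rewrite side_le ltW.
  rewrite mulrCA -exprS; apply: (@le_lt_trans _ _ (delta / 2)); last by lra.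
  rewrite -ler_pdivlMr ?exprn_gt0 // -mulrA -invfM.
  by rewrite ge_min lexx orbT.
pose M := \big[Num.max/0]_j `|x ord0 j - y ord0 j|.
have M0 : 0 < M.
  apply: (lt_le_trans _ (le_bigmax _ _ ord0)).
  by rewrite normr_gt0 subr_eq0 lt_eqF // -subr_gt0 xyE.
(* Chosen after the interval, [alpha] is at most its regularity quotient; [1 / 2] keeps it below
   1. *)
pose alpha := Num.min (1 / 2) (\prod_j side j / M ^+ n.+2).
have alpha01 : 0 < alpha < 1.
  have half : 0 < (1 / 2 : R) < 1 by lra.
  have [half0 half1] := andP half.
  by rewrite lt_min gt_min half0 half1 andbT divr_gt0 ?exprn_gt0.
suff: false by [].
have := AC alpha alpha01 1%N (fun=> x) (fun=> y).
rewrite !big_ord1 volE lte_fin fE distrC xyE /side eqxx gtr0_norm // ltxx.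
apply=> //.
- by move=> _; rewrite /alpha_regular volE /= -/M ge_min lexx orbT.
- move=> _ z xyz; apply: xr => j; have /andP[-> zy] := xyz j.
  by rewrite (le_trans zy) // mxE lerD2l.
- by move=> i j _ _ _; rewrite (ord1 i) (ord1 j).
Qed.

Theorem corollary3p3 (R : realType) (n l : nat) (Omega : set 'rV[R]_n)
    (hn : (0 < n)%N) (hl : (0 < l)%N) (hOmega : open Omega) :
  (forall alpha beta : R, 0 < alpha < 1 -> 0 < beta < 1 ->
     alphaAC (l := l) alpha Omega = alphaAC (l := l) beta Omega)
  /\
  ((1 < n)%N -> Omega !=set0 ->
   exists f : 'rV[R]_n -> 'rV[R]_l,
     (forall alpha : R, 0 < alpha < 1 -> alphaAC alpha Omega f) /\
     ~ (forall eps : R, 0 < eps ->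
          exists2 delta : R, 0 < delta &
            forall alpha : R, 0 < alpha < 1 ->
              AC_implication Omega f alpha eps delta)).
Proof.
split.
  case: n Omega hn hOmega => // n Omega _ _ alpha beta alpha01 beta01.
  have [alpha0 _] := andP alpha01; have [beta0 _] := andP beta01.
  by apply/seteqP; split; exact: alphaAC_subset.
(* In dimension 1 every nondegenerate interval has regularity quotient 1, so [delta] is uniform
   there; a long and a short side require dimension at least 2. *)
case: n Omega hn hOmega => [|[|n]] // Omega _ oO _ O0.
case: l hl => // l _.
pose f (x : 'rV[R]_n.+2) : 'rV[R]_l.+1 := x ord0 ord0 *: delta_mx ord0 ord0.
have fE x y : enorm (f x - f y) = `|x ord0 ord0 - y ord0 ord0|.
  rewrite /f -scalerBl /enorm big_ord_recl big1 => [|j _].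
    by rewrite !mxE !eqxx mulr1 addr0 sqrtr_sqr.
  by rewrite !mxE /= mulr0 expr0n.
exists f; split=> [alpha /andP[alpha0 _]|].
  by apply: lipschitz_alphaAC => // x y; rewrite fE (le_bigmax _ _ ord0).
exact: first_coordinate_not_uniformly_AC.
Qed.
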